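(* For every integer $n\geq 0$, \begin{align*} \overline{p}_{-7}(8n+1) &\equiv 0 \pmod{2}, & \overline{p}_{-7}(8n+2) &\equiv 0 \pmod{16}, & \overline{p}_{-7}(8n+3) &\equiv 0 \pmod{32}, \\ \overline{p}_{-7}(8n+4) &\equiv 0 \pmod{2}, & \overline{p}_{-7}(8n+7) &\equiv 0 \pmod{128}. \end{align*}
   Context: For $|q|<1$ let $(a;q)_\infty=\prod_{i\geq 0}(1-aq^i)$. For a positive integer $t$, the number $\overline{p}_{-t}(n)$ of $t$-colored overpartitions of $n$ is defined by the generating function \[ \sum_{n\geq 0}\overline{p}_{-t}(n)q^n=\frac{(q^2;q^2)_\infty^t}{(q;q)_\infty^{2t}}. \] *)

(* Defs.v *)
From HB Require Import structures.
From mathcomp Require Import all_boot all_order all_algebra.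
From mathcomp Require Import boolp.

Set Implicit Arguments.
Unset Strict Implicit.
Unset Printing Implicit Defensive.

Import GRing.Theory.
Local Open Scope ring_scope.

(* The ring Z[[q]] of formal power series; [f n] is the coefficient of q^n.
   The record keeps the Cauchy product apart from pointwise operations. *)
Record fps := Fps { fps_coef :> nat -> int }.

Lemma fpsP (f g : fps) : (forall n, f n = g n) -> f = g.
Proof. by case: f g => [f] [g] /= fg; congr Fps; apply: funext. Qed.

HB.instance Definition _ := gen_eqMixin fps.
HB.instance Definition _ := gen_choiceMixin fps.

Definition fps_zero := Fps (fun _ => 0).
Definition fps_opp (f : fps) := Fps (fun n => - f n).
Definition fps_add (f g : fps) := Fps (fun n => f n + g n).
Definition fps_one := Fps (fun n => (n == 0)%:R).
Definition fps_mul (f g : fps) := Fps (fun n => \sum_(i < n.+1) f i * g (n - i)%N).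

Lemma fps_addA : associative fps_add.
Proof. by move=> f g h; apply: fpsP => n /=; rewrite addrA. Qed.
Lemma fps_addC : commutative fps_add.
Proof. by move=> f g; apply: fpsP => n /=; rewrite addrC. Qed.
Lemma fps_add0 : left_id fps_zero fps_add.
Proof. by move=> f; apply: fpsP => n /=; rewrite add0r. Qed.
Lemma fps_addN : left_inverse fps_zero fps_opp fps_add.
Proof. by move=> f; apply: fpsP => n /=; rewrite addNr. Qed.

HB.instance Definition _ :=
  GRing.isZmodule.Build fps fps_addA fps_addC fps_add0 fps_addN.

Definition fps_trunc (N : nat) (f : fps) : {poly int} := \poly_(i < N) f i.

Lemma coef_fps_trunc_mul N (f g : fps) n : (n < N)%N ->
  (fps_trunc N f * fps_trunc N g)`_n = fps_mul f g n.
Proof.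
move=> nN; rewrite coefM /=; apply: eq_bigr => i _.
by rewrite !coef_poly (leq_ltn_trans (leq_subr _ _) nN)
  (leq_ltn_trans _ nN) // -ltnS.
Qed.

Lemma fps_mulC : commutative fps_mul.
Proof.
move=> f g; apply: fpsP => n.
by rewrite -!(@coef_fps_trunc_mul n.+1) // mulrC.
Qed.

Lemma fps_mulA : associative fps_mul.
Proof.
move=> f g h; apply: fpsP => n.
have mulL (p : {poly int}) (u v : fps) :
    (fps_trunc n.+1 (fps_mul u v) * p)`_n
    = (fps_trunc n.+1 u * fps_trunc n.+1 v * p)`_n.
  rewrite !coefM; apply: eq_bigr => i _; congr (_ * _).
  by rewrite coef_poly ltn_ord coef_fps_trunc_mul // coefM.
rewrite -!(@coef_fps_trunc_mul n.+1) // mulL [in LHS]mulrC mulL.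
by rewrite [in LHS]mulrC mulrA.
Qed.

Lemma fps_mul1 : left_id fps_one fps_mul.
Proof.
move=> f; apply: fpsP => n /=.
rewrite big_ord_recl /= mul1r subn0 big1 ?addr0 // => i _.
by rewrite mul0r.
Qed.

Lemma fps_mulDl : left_distributive fps_mul fps_add.
Proof.
move=> f g h; apply: fpsP => n /=; rewrite -big_split /=.
by apply: eq_bigr => i _; rewrite mulrDl.
Qed.

Lemma fps_one_neq0 : fps_one != 0 :> fps.
Proof. by apply/eqP => /(congr1 (fun f : fps => f 0%N)). Qed.

HB.instance Definition _ := GRing.Zmodule_isComNzRing.Build fps
  fps_mulA fps_mulC fps_mul1 fps_mulDl fps_one_neq0.

Lemma coef_fps0 n : (0 : fps) n = 0. Proof. by []. Qed.
Lemma coef_fps1 n : (1 : fps) n = (n == 0)%:R. Proof. by []. Qed.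
Lemma coef_fpsD (f g : fps) n : (f + g) n = f n + g n. Proof. by []. Qed.
Lemma coef_fpsN (f : fps) n : (- f) n = - f n. Proof. by []. Qed.
Lemma coef_fpsB (f g : fps) n : (f - g) n = f n - g n. Proof. by []. Qed.
Lemma coef_fpsM (f g : fps) n :
  (f * g) n = \sum_(i < n.+1) f i * g (n - i)%N.
Proof. by []. Qed.

Lemma coef_fps_sum (I : Type) (r : seq I) (P : pred I) (F : I -> fps) n :
  (\sum_(i <- r | P i) F i) n = \sum_(i <- r | P i) F i n.
Proof. exact: (big_morph (fun f : fps => f n)). Qed.

Lemma coef_fpsM0 (f g : fps) : (f * g) 0%N = f 0%N * g 0%N.
Proof. by rewrite coef_fpsM big_ord1. Qed.

Lemma coef_fpsX_lt (f : fps) k n : f 0%N = 0 -> (n < k)%N -> (f ^+ k) n = 0.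
Proof.
move=> f0; elim: k n => // k IH n nk.
rewrite exprS coef_fpsM big_ord_recl f0 mul0r add0r big1 // => i _ /=.
rewrite IH ?mulr0 // /bump leq0n add1n; case: n nk i => [|n] nk [i Hi] //=.
by rewrite subSS (leq_ltn_trans (leq_subr _ _)).
Qed.

Definition fps_const (c : int) : fps := Fps (fun n => if n == 0%N then c else 0).

Lemma coef_fps_constM c (f : fps) n : (fps_const c * f) n = c * f n.
Proof.
rewrite coef_fpsM big_ord_recl /= subn0 big1 ?addr0 // => i _.
by rewrite mul0r.
Qed.

Definition fps_unit : pred fps := [pred f : fps | f 0%N \is a GRing.unit].

(* If f = c (1 - h) with c a unit and h without constant term, then
   1 / f = c^-1 \sum_k h^k, and the terms k > n do not contribute to the
   coefficient of q^n. *)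
Definition fps_geom (f : fps) : fps :=
  Fps (fun n =>
    (f 0%N)^-1 * \sum_(k < n.+1) ((1 - fps_const (f 0%N)^-1 * f) ^+ k) n).

Definition fps_inv (f : fps) : fps := if fps_unit f then fps_geom f else f.

Lemma fps_mulVr : {in fps_unit, left_inverse 1 fps_inv *%R}.
Proof.
move=> f uf; rewrite /fps_inv ifT //.
move: uf; rewrite unfold_in /= => uf.
set c := (f 0%N)^-1; set h := 1 - fps_const c * f.
have h0 : h 0%N = 0.
  by rewrite coef_fpsB coef_fps_constM /= mulVr ?subrr.
apply: fpsP => n.
have -> : (fps_geom f * f) n
        = ((\sum_(k < n.+1) h ^+ k) * (fps_const c * f)) n.
  rewrite mulrCA coef_fps_constM !coef_fpsM mulr_sumr.
  apply: eq_bigr => i _; rewrite mulrA; congr (_ * _).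
  rewrite /fps_geom /= coef_fps_sum; congr (_ * _).
  rewrite (big_ord_widen n.+1 (fun k => (h ^+ k) i)) //.
  rewrite [RHS](bigID (fun k : 'I_n.+1 => (k < i.+1)%N)) /=.
  rewrite [X in _ = _ + X]big1 ?addr0 // => k; rewrite -leqNgt => ik.
  by rewrite coef_fpsX_lt.
have -> : fps_const c * f = - (h - 1) by rewrite /h addrAC subrr add0r opprK.
rewrite mulrN [X in - X]mulrC -subrX1 opprB coef_fpsB coef_fpsX_lt //.
by rewrite subr0.
Qed.

Lemma fps_unitPl (f g : fps) : g * f = 1 -> fps_unit f.
Proof.
move=> /(congr1 (fun u : fps => u 0%N)); rewrite coef_fpsM0 => gf.
by apply/unitrPr; exists (g 0%N); rewrite mulrC.
Qed.

Lemma fps_inv_out : {in [predC fps_unit], fps_inv =1 id}.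
Proof. by move=> f /negbTE uf; rewrite /fps_inv ifF. Qed.

HB.instance Definition _ := GRing.ComNzRing_hasMulInverse.Build fps
  fps_mulVr fps_unitPl fps_inv_out.

Definition fps_q : fps := Fps (fun n => (n == 1)%:R).
Notation "''q'" := fps_q.

(* (a; x)_oo = \prod_(i >= 0) (1 - a x^i), where x has zero constant term (the
   formal counterpart of |x| < 1): the coefficient of q^n is unchanged by the
   factors with i > n, see [coef_qpoch]. *)
Definition qpoch (a x : fps) : fps :=
  Fps (fun n => (\prod_(i < n.+1) (1 - a * x ^+ i)) n).

Lemma coef_qpoch (a x : fps) n N : x 0%N = 0 -> (n < N)%N ->
  qpoch a x n = (\prod_(i < N) (1 - a * x ^+ i)) n.
Proof.
move=> x0; elim: N => // N IH; rewrite ltnS leq_eqVlt => /predU1P[-> //|nN].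
rewrite (IH nN).
rewrite [in RHS](big_ord_recr N) [X in _ = _ X n]/= mulrBr mulr1 coef_fpsB.
rewrite [X in _ - X](_ : _ = 0) ?subr0 // coef_fpsM big1 // => i _.
rewrite [X in _ * X]coef_fpsM [X in _ * X]big1 ?mulr0 // => j _.
rewrite coef_fpsX_lt ?mulr0 // -subnDA.
exact: leq_ltn_trans (leq_subr _ _) nN.
Qed.

Lemma qpoch_unit (a x : fps) : a 0%N = 0 -> qpoch a x \is a GRing.unit.
Proof.
move=> a0; suff e : qpoch a x 0%N = 1 by change (qpoch a x 0%N \is a GRing.unit); rewrite e unitr1.
by rewrite /qpoch /= big_ord1 coef_fpsB coef_fpsM0 a0 mul0r subr0.
Qed.

Definition overpartition_gf (t : nat) : fps :=
  qpoch ('q ^+ 2) ('q ^+ 2) ^+ t / qpoch 'q 'q ^+ (2 * t).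

(* The number of [t]-colored overpartitions of [n], \overline{p}_{-t}(n) in the
   literature. *)
Definition overp (t n : nat) : int := overpartition_gf t n.

Lemma overpartition_gfE t :
  overpartition_gf t * qpoch 'q 'q ^+ (2 * t) = qpoch ('q ^+ 2) ('q ^+ 2) ^+ t.
Proof. by rewrite divrK // unitrX // qpoch_unit. Qed.

(* Main.v *)
Require Import Defs.
From mathcomp Require Import all_boot all_order all_algebra.
From mathcomp Require Import ring zify.
Local Open Scope ring_scope.
Import GRing.Theory.

(** The inverse of the generating function of overpartitions is Gauss' theta
    series phi = \sum_s (-1)^s q^(s^2), as the limit of Shanks' finite identity
    shows.  Since phi is 1 modulo 2, phi^64 is 1 modulo 128, so that
    phi^(-7) = phi^57 modulo 128.  Separating even and odd s, phi = a - 2 x where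
    a is a series in q^4, congruent to 1 modulo 2, and the exponents of x are 1
    modulo 8.  In the binomial expansion of (a - 2 x)^57 only the terms
    'C(57, i) (-2 x)^i a^(57 - i) with i = n modulo 4 reach q^n; the factor 2^i
    suffices for i > 3, and 4 divides 'C(57, 2) and 'C(57, 3).  For n = 7 modulo
    8, the term i = 3 gains another factor 4 because a^54 is 1 modulo 4. *)

(** * Shanks' finite theta identity *)

Section Shanks.
Context (R : comNzRingType) (q : R).

Let m k := \prod_(i < k) (1 + q ^+ i.+1).
Let d n k := \prod_(k <= i < n) (1 - q ^+ i.+1).

(** With [m k] = (-q;q)_k and [d n k] = (q^(k+1);q)_(n-k), this is the summand of index s + 1 in
    Shanks' sum; the one of index 0 is [d n 0]. *)
Definition shanks_term (n s : nat) : R :=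
  (-1) ^+ s.+1 * q ^+ (s.+1 * n.+1) * m s * d n s.+1.

(** The right side is 0 at k = 0, and its increment from k to k + 1 is the summand of index k. *)
Lemma shanks_telescope n k : (k <= n)%N ->
  \sum_(s < k) (shanks_term n.+1 s - (1 + q ^+ n.+1) * shanks_term n s)
  = q ^+ n.+1 * d n 0 - (-1) ^+ k * q ^+ (k.+1 * n.+1) * m k * d n k.
Proof.
elim: k => [_|k IH kn].
  by rewrite big_ord0 /m big_ord0 mul1n expr0; ring.
rewrite big_ord_recr /= IH ?(ltnW kn) // /shanks_term.
have -> : d n.+1 k.+1 = d n k.+1 * (1 - q ^+ n.+1) by rewrite /d big_nat_recr.
have -> : d n k = (1 - q ^+ k.+1) * d n k.+1 by rewrite /d big_ltn.
have -> : m k.+1 = m k * (1 + q ^+ k.+1) by rewrite /m big_ord_recr.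
have -> : q ^+ (k.+1 * n.+2) = q ^+ (k.+1 * n.+1) * q ^+ k.+1.
  by rewrite -exprD; congr (_ ^+ _); lia.
have -> : q ^+ (k.+2 * n.+1) = q ^+ (k.+1 * n.+1) * q ^+ n.+1.
  by rewrite -exprD; congr (_ ^+ _); lia.
rewrite [(-1) ^+ k.+1]exprS.
ring.
Qed.

(* Shanks' finite form of Gauss' theta identity, with denominators cleared. *)
Lemma shanks n :
  d n 0 + 2 * (\sum_(s < n) shanks_term n s)
  = m n * (1 + 2 * \sum_(s < n) (-1) ^+ s.+1 * q ^+ (s.+1 ^ 2)).
Proof.
elim: n => [|n IH]; first by rewrite /m /d !big_ord0 big_geq //; ring.
have -> : m n.+1 = m n * (1 + q ^+ n.+1) by rewrite /m big_ord_recr.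
rewrite big_ord_recr [in RHS]big_ord_recr /=.
(* This trades row n + 1 for 1 + q^(n+1) times row n, to which the induction hypothesis applies. *)
have := @shanks_telescope n n (leqnn n).
rewrite sumrB -mulr_sumr => /(canRL (subrK _)) ->.
have -> : d n.+1 0 = d n 0 * (1 - q ^+ n.+1) by rewrite /d big_nat_recr.
have dnn k : d k k = 1 by rewrite /d big_geq.
rewrite /shanks_term !dnn.
have -> : q ^+ (n.+1 * n.+2) = q ^+ (n.+1 ^ 2) * q ^+ n.+1.
  by rewrite -exprD; congr (_ ^+ _); lia.
rewrite -[(n.+1 * n.+1)%N]/(n.+1 ^ 2)%N [(-1) ^+ n.+1]exprS.
set A := \sum_(_ < _) _ in IH *; set B := \sum_(_ < _) _ in IH *.
have -> : m n * (1 + q ^+ n.+1)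
   * (1 + 2 * (B + -1 * (-1) ^+ n * q ^+ (n.+1 ^ 2)))
  = (1 + q ^+ n.+1) * (m n * (1 + 2 * B))
    - 2 * m n * (1 + q ^+ n.+1) * (-1) ^+ n * q ^+ (n.+1 ^ 2) by ring.
rewrite -IH; ring.
Qed.

End Shanks.

Lemma coef_fpsMn (f : fps) k n : (f *+ k) n = f n *+ k.
Proof. by elim: k => [|k IH]; rewrite ?mulr0n // !mulrS coef_fpsD IH. Qed.

Lemma coef_fpsMsign (f : fps) k n : ((-1) ^+ k * f) n = (-1) ^+ k * f n.
Proof.
by elim: k => [|k IH]; rewrite ?expr0 ?mul1r // !exprS -!mulrA !mulN1r coef_fpsN IH.
Qed.

Lemma coef_fps_qM (f : fps) n : ('q * f) n = if n is k.+1 then f k else 0.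
Proof.
rewrite coef_fpsM; case: n => [|n]; first by rewrite big_ord1 mul0r.
rewrite !big_ord_recl big1 => [|i _]; last by rewrite mul0r.
by rewrite mul0r mul1r add0r addr0 subSS subn0.
Qed.

Lemma coef_fps_qXM k (f : fps) n :
  ('q ^+ k * f) n = if (n < k)%N then 0 else f (n - k)%N.
Proof.
elim: k n => [|k IH] n; first by rewrite expr0 mul1r subn0.
by rewrite exprS -mulrA coef_fps_qM; case: n => [|n] //; rewrite IH.
Qed.

Lemma coef_fps_qX k n : ('q ^+ k) n = (n == k)%:R.
Proof.
rewrite -[_ ^+ _]mulr1 coef_fps_qXM; case: ltngtP => // [h|->].
  by rewrite coef_fps1 subn_eq0 leqNgt h.
by rewrite subnn.
Qed.

Lemma coef_fpsM_eq (f f' g g' : fps) n :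
  (forall k, (k <= n)%N -> f k = f' k) -> (forall k, (k <= n)%N -> g k = g' k) ->
  (f * g) n = (f' * g') n.
Proof.
move=> ff gg; rewrite !coef_fpsM; apply: eq_bigr => i _.
by rewrite ff ?gg ?leq_subr // -ltnS.
Qed.

(** * Gauss' theta series *)

Definition theta_part (b : bool) : fps :=
  Fps (fun n => \sum_(s < n | odd s.+1 == b) (n == s.+1 ^ 2)%N%:R).

(** This is phi = a - 2 x, with a = [1 + theta_part false *+ 2] and x = [theta_part true]; the
    factors 2 pair s with -s. *)
Definition theta_neg : fps := 1 + theta_part false *+ 2 - theta_part true *+ 2.

Lemma coef_theta_part b N n : (n <= N)%N ->
  theta_part b n = \sum_(s < N | odd s.+1 == b) (n == s.+1 ^ 2)%N%:R.
Proof.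
move=> nN; rewrite /=.
rewrite (big_ord_widen_cond N (fun s => odd s.+1 == b)
  (fun s => (n == s.+1 ^ 2)%N%:R : int)) //.
rewrite [RHS](bigID (fun s : 'I_N => (s < n)%N)) /=.
rewrite [X in _ = _ + X]big1 ?addr0 // => s /andP[_ sn].
by case: eqP => // e; exfalso; nia.
Qed.

Lemma coef_theta_neg N n : (n <= N)%N ->
  theta_neg n =
  (1 + 2 * \sum_(s < N) (-1) ^+ s.+1 * 'q ^+ (s.+1 ^ 2) : fps) n.
Proof.
move=> nN; rewrite mulr_natl [RHS]coef_fpsD coef_fpsMn coef_fps_sum.
have -> : theta_neg n
    = (n == 0)%:R + theta_part false n *+ 2 - theta_part true n *+ 2.
  by rewrite coef_fpsB coef_fpsD !coef_fpsMn.
rewrite !(coef_theta_part _ _ _ nN) -addrA -mulrnBl; congr (_ + _ *+ 2).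
rewrite [RHS](bigID (fun s : 'I_N => odd s.+1 == false)) -sumrN.
congr (_ + _); apply: eq_big => s //; try by [case: (odd s.+1)];
  rewrite coef_fpsMsign coef_fps_qX -signr_odd;
  by case: (odd s.+1) => // _; rewrite ?expr1 ?mulN1r ?mul1r.
Qed.

Lemma coef_qpoch_q N n : (n <= N)%N ->
  qpoch 'q 'q n = (\prod_(0 <= i < N.+1) (1 - 'q ^+ i.+1) : fps) n.
Proof.
move=> nN; rewrite (@coef_qpoch _ _ _ N.+1) // big_mkord.
by congr fps_coef; apply: eq_bigr => i _; rewrite exprS.
Qed.

Lemma coef_qpoch_Nq N n : (n <= N)%N ->
  qpoch (- 'q) 'q n = (\prod_(i < N.+1) (1 + 'q ^+ i.+1) : fps) n.
Proof.
move=> nN; rewrite (@coef_qpoch _ _ _ N.+1) //.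
by congr fps_coef; apply: eq_bigr => i _; rewrite exprS mulNr opprK.
Qed.

Lemma gauss_theta : qpoch (- 'q) 'q * theta_neg = qpoch 'q 'q.
Proof.
apply: fpsP => n.
rewrite (coef_fpsM_eq _ _ _ _ _
  (fun k h => coef_qpoch_Nq n k h)
  (fun k h => coef_theta_neg n.+1 k (leqW h))).
(* In Shanks' identity at n + 1 the correction terms carry q^((s+1)(n+2)), beyond degree n. *)
rewrite -shanks (coef_qpoch_q n n) // coef_fpsD mulr_natl coef_fpsMn coef_fps_sum.
rewrite -[RHS]addr0; congr (_ + _).
rewrite big1 ?mul0rn // => s _; rewrite /shanks_term.
have : (n < s.+1 * n.+2)%N by nia.
move: (s.+1 * n.+2)%N => e ne.
by rewrite -2!mulrA coef_fpsMsign coef_fps_qXM ne mulr0.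
Qed.

Lemma qpoch_q2 : qpoch ('q ^+ 2) ('q ^+ 2) = qpoch 'q 'q * qpoch (- 'q) 'q.
Proof.
apply: fpsP => n.
rewrite (coef_fpsM_eq _ _ _ _ _
  (fun k h => coef_qpoch_q n k h) (fun k h => coef_qpoch_Nq n k h)).
rewrite (@coef_qpoch _ _ _ n.+1) ?coef_fps_qX // big_mkord -big_split /=.
congr fps_coef; apply: eq_bigr => i _.
by rewrite -exprS -exprM mulnC exprM; ring.
Qed.

(** The quotient (q^2;q^2) / (q;q)^2 is (-q;q) / (q;q), the inverse of phi. *)
Lemma overpartition_gf_theta t : overpartition_gf t * theta_neg ^+ t = 1.
Proof.
have uE : qpoch 'q 'q ^+ (2 * t) \is a GRing.unit by rewrite unitrX // qpoch_unit.
apply: (mulIr uE); rewrite mulrAC overpartition_gfE mul1r qpoch_q2 -exprMn.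
by rewrite -mulrA gauss_theta exprM.
Qed.

(** * Powers modulo powers of 2 *)

Lemma exprD1_exp2 (R : comNzRingType) k (u : R) :
  exists v, (1 + u *+ 2) ^+ (2 ^ k) = 1 + v *+ 2 ^ k.+1.
Proof.
elim: k => [|k [v IH]]; first by exists u.
(* Squaring 1 + 2^(k+1) v gives 1 + 2^(k+2) (v + 2^k v^2). *)
exists (v + v ^+ 2 *+ 2 ^ k).
rewrite expnSr exprM IH !expnS; move: (2 ^ k)%N => c.
by ring.
Qed.

Lemma exprD1_mod (R : comNzRingType) m (u : R) k :
  exists v, (1 + u *+ m) ^+ k = 1 + v *+ m.
Proof.
elim: k => [|k [v IH]]; first by exists 0; rewrite mul0rn addr0.
exists (u + v + u * v *+ m).
by rewrite exprS IH; ring.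
Qed.

(** * Supports in residue classes *)

Definition supported_mod (d r : nat) (f : fps) :=
  forall n, n != r %[mod d] -> f n = 0.

Lemma supported_modM d r s f g :
  supported_mod d r f -> supported_mod d s g -> supported_mod d (r + s) (f * g).
Proof.
move=> hf hg n hn; rewrite coef_fpsM big1 // => i _.
case: (eqVneq (i %% d)%N (r %% d)%N) => [hi|/hf->]; last by rewrite mul0r.
rewrite hg ?mulr0 //; apply: contraNneq hn => hs.
have <- : (i + (n - i))%N = n by rewrite subnKC // -ltnS.
by rewrite -modnDm hi hs modnDm.
Qed.

Lemma supported_modX d r f k :
  supported_mod d r f -> supported_mod d (k * r) (f ^+ k).
Proof.
move=> hf; elim: k => [|k IH]; last by rewrite exprS mulSn; apply: supported_modM.
by move=> [|n]; rewrite mul0n expr0 // eqxx.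
Qed.

Lemma supported_mod_even : supported_mod 4 0 (1 + theta_part false *+ 2).
Proof.
move=> n hn; rewrite coef_fpsD coef_fpsMn coef_fps1 /= big1 => [|s /eqP hs].
  by case: n hn.
case: (n =P (s.+1 ^ 2)%N) => // e; case/eqP: hn; rewrite e.
have -> : s.+1 = s.+1./2.*2 by have := odd_double_half s.+1; rewrite [odd s.+1]hs.
by rewrite -muln2 expnMn modnMl.
Qed.

Lemma supported_mod_odd : supported_mod 8 1 (theta_part true).
Proof.
move=> n hn; rewrite /= big1 // => s /eqP hs.
case: (n =P (s.+1 ^ 2)%N) => // e; case/eqP: hn; rewrite e.
(* Odd squares are 1 modulo 8, checked residue by residue. *)
have : (odd (s.+1 %% 8))%N by rewrite odd_mod.
rewrite -modnXm; have : (s.+1 %% 8 < 8)%N by rewrite ltn_pmod.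
by move: (s.+1 %% 8)%N; do 8?[case=> //].
Qed.

Lemma supported_mod_dvd d e r f :
  (d %| e)%N -> supported_mod e r f -> supported_mod d r f.
Proof.
move=> de hf n hn; apply: hf; apply: contraNneq hn => h.
by rewrite -(modn_dvdm n de) h modn_dvdm.
Qed.

(** * Reduction to binomial terms and the congruences *)

Lemma inv_exp_mod (R : comNzRingType) (f g u : R) a b k :
  f = 1 + u *+ 2 -> g * f ^+ a = 1 -> (a + b)%N = (2 ^ k)%N ->
  exists w, g = f ^+ b + w *+ 2 ^ k.+1.
Proof.
move=> fu gf ab; have [v] := exprD1_exp2 _ k u; rewrite -fu -ab exprD => e.
exists (- (g * v)).
have -> : f ^+ b = g + (g * v) *+ 2 ^ k.+1.
  by rewrite -[LHS]mul1r -gf -mulrA e mulrDr mulr1 mulrnAr.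
by rewrite mulNrn addrK.
Qed.

Lemma overp7_theta n : exists w, overp 7 n = (theta_neg ^+ 57) n + w *+ 2 ^ 7.
Proof.
have e : theta_neg = 1 + (theta_part false - theta_part true) *+ 2.
by rewrite mulrnBl addrA.
(* Here 7 + 57 = 2^6, and the modulus is 2^(6+1). *)
have [w hw] := inv_exp_mod _ _ _ _ 7 57 6 e (overpartition_gf_theta 7) erefl.
by exists (w n); rewrite /overp hw coef_fpsD coef_fpsMn.
Qed.

Lemma coef_theta_negX k n : (theta_neg ^+ k) n =
  \sum_(i < k.+1) (-1) ^+ i *
    ((1 + theta_part false *+ 2) ^+ (k - i) * theta_part true ^+ i) n
      *+ (2 ^ i * 'C(k, i)).
Proof.
rewrite /theta_neg exprBn coef_fps_sum; apply: eq_bigr => i _.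
by rewrite exprMn_n mulrnAr -mulrnA -mulrA coef_fpsMn coef_fpsMsign.
Qed.

Lemma supported_mod_theta_term k i :
  supported_mod 4 i ((1 + theta_part false *+ 2) ^+ k * theta_part true ^+ i).
Proof.
have h8 : supported_mod 4 1 (theta_part true).
  by apply: (@supported_mod_dvd 4 8) => //; exact: supported_mod_odd.
have := supported_modM _ _ _ _ _
  (supported_modX 4 0 _ k supported_mod_even) (supported_modX 4 1 _ i h8).
by rewrite muln0 muln1 add0n.
Qed.

Lemma dvdz_mulrn (m k : nat) (x : int) : (m %| k)%N -> (m %| x *+ k)%Z.
Proof. by move=> mk; rewrite -mulr_natr natz dvdz_mull. Qed.

(** Terms with i >= e are killed by 2^i, those with i not n modulo 4 by their support; e <= 7 since
    phi^57 represents phi^(-7) modulo 2^7. *)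
Lemma dvdz_overp7 e n : (e <= 7)%N ->
  (forall i : 'I_58, (i < e)%N -> (i = n %[mod 4])%N ->
    (Posz (2 ^ e) %| ((1 + theta_part false *+ 2) ^+ (57 - i) * theta_part true ^+ i) n
       *+ (2 ^ i * 'C(57, i)))%Z) ->
  (overp 7 n = 0 %[mod (2 ^ e)%N])%Z.
Proof.
move=> he h; apply/eqP; rewrite eqz_mod_dvd subr0.
have [w ->] := overp7_theta n.
apply: rpredD; last by rewrite dvdz_mulrn // (dvdn_exp2l 2 he).
rewrite coef_theta_negX; apply: rpred_sum => i _.
rewrite -mulrnAr; apply: dvdz_mull.
have [ie|ei] := ltnP i e; last first.
  by apply/dvdz_mulrn/dvdn_mulr; exact: dvdn_exp2l.
case: (eqVneq (n %% 4)%N (i %% 4)%N) => [/esym /h|hn]; first exact.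
by rewrite supported_mod_theta_term // mul0rn dvdz0.
Qed.

Theorem theorem1p2 (n : nat) :
  [/\ (overp 7 (8 * n + 1)%N = 0 %[mod 2])%Z,
      (overp 7 (8 * n + 2)%N = 0 %[mod 16])%Z,
      (overp 7 (8 * n + 3)%N = 0 %[mod 32])%Z,
      (overp 7 (8 * n + 4)%N = 0 %[mod 2])%Z
    & (overp 7 (8 * n + 7)%N = 0 %[mod 128])%Z].
Proof.
have even_term k : (0 < k)%N -> (overp 7 k = 0 %[mod 2])%Z.
  move=> k0; apply: (@dvdz_overp7 1 k) => // i; rewrite ltnS leqn0 => /eqP -> _.
  (* Only i = 0 is left, and a^57 is 1 modulo 2. *)
  have [v ->] := exprD1_mod _ 2 (theta_part false) (57 - 0).
  rewrite expr0 mulr1 mul1n bin0 coef_fpsD coef_fps1 gtn_eqF // add0r coef_fpsMn.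
  by rewrite -mulrnA dvdz_mulrn.
split; try by apply: even_term; rewrite addn_gt0 orbT.
- apply: (@dvdz_overp7 4) => // i i4 hi.
  have -> : nat_of_ord i = 2 by lia.
  (* The factor is 4 * 1596 = 16 * 399. *)
  by apply: dvdz_mulrn; vm_compute.
- apply: (@dvdz_overp7 5) => // i i4 hi.
  have -> : nat_of_ord i = 3 by lia.
  (* The factor is 8 * 29260 = 32 * 7315. *)
  by apply: dvdz_mulrn; vm_compute.
apply: (@dvdz_overp7 7) => // i i4 hi.
have -> : nat_of_ord i = 3 by lia.
(* The binomial factor yields only 2^5; a^54 = (a^2)^27 = 1 + 4 v supplies the missing 4. *)
have [u hu] := exprD1_exp2 _ 1 (theta_part false).
have [v hv] := exprD1_mod _ 4 u 27.
have -> : (1 + theta_part false *+ 2) ^+ (57 - 3) = 1 + v *+ 4.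
  by rewrite -hv -hu -exprM.
(* The summand 1 of 1 + 4 v leaves x^3, whose exponents are 3 modulo 8, never 7. *)
rewrite mulrDl mul1r coef_fpsD (supported_modX _ _ _ 3 supported_mod_odd).
  by rewrite add0r mulrnAl coef_fpsMn -mulrnA dvdz_mulrn //; vm_compute.
by apply/eqP; lia.
Qed.
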